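(* Define a sequence $(\mathbf{D}^{(i)})_{i\ge 0}$ of $2\times2$ integer matrices by $\mathbf{D}^{(0)}=\mathbf{I}$ (the identity matrix) and, writing $\mathbf{D}^{(i)}=\begin{pmatrix}D_{00}&D_{01}\\ D_{10}&D_{11}\end{pmatrix}$, $$\mathbf{D}^{(i+1)}=\begin{cases}\begin{pmatrix}1&0\\ D_{01}+D_{11}&1\end{pmatrix}&\text{if } D_{00}+D_{10}=1,\\[3mm] \mathbf{D}^{(i)}\begin{pmatrix}2j+1&1\\ -1&0\end{pmatrix},\ \ j=\left\lfloor\dfrac{D_{01}+D_{11}-1}{D_{00}+D_{10}}\right\rfloor,&\text{if } D_{00}+D_{10}\neq1.\end{cases}$$ Then the sequence is well defined and for every $i\ge0$, $\mathbf{D}^{(i)}=\mu(s_i)$, where $s_0,s_1,s_2,\dots$ is the list of all finite strings over $\{\mathrm{L},\mathrm{R}\}$ in level order; that is, the sequence enumerates the tree of products of $\mathbf{L}$ and $\mathbf{R}$ level by level and from left to right within each level. Consequently: (a) the sequence of rationals $\frac{p_i}{q_i}$ with $\begin{pmatrix}p_i\\ q_i\end{pmatrix}=\mathbf{D}^{(i)}\begin{pmatrix}1\\ 1\end{pmatrix}$ enumerates every positive rational exactly once, in lowest form, in the level-by-level, left-to-right order of the Stern-Brocot tree; (b) the sequence of rationals $\frac{n_i}{m_i}$ with $(m_i\ \ n_i)=(1\ \ 1)\,\mathbf{D}^{(i)}$ enumerates every positive rational exactly once, in lowest form, in the level-by-level, left-to-right order of the Eisenstein-Stern (Calkin-Wilf)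 tree.
   Context: Let $\mathbf{L}=\begin{pmatrix}1&0\\ 1&1\end{pmatrix}$ and $\mathbf{R}=\begin{pmatrix}1&1\\ 0&1\end{pmatrix}$. Let $\mu$ be the monoid homomorphism from finite strings over $\{\mathrm{L},\mathrm{R}\}$ (under concatenation) to $2\times2$ integer matrices (under multiplication) with $\mu(\mathrm{L})=\mathbf{L}$, $\mu(\mathrm{R})=\mathbf{R}$; the empty string is mapped to $\mathbf{I}$. Level order on strings: shorter strings come first, and strings of equal length are ordered lexicographically with $\mathrm{L}<\mathrm{R}$. The tree of products is the infinite binary tree whose root is $\mathbf{I}$ and in which the node reached from the root by the string $s$ of left (L) and right (R) branches is $\mu(s)$; so a node $\mathbf{D}$ has left child $\mathbf{D}\mathbf{L}$ and right child $\mathbf{D}\mathbf{R}$. The Stern-Brocot tree is obtained by replacing each node $\mathbf{D}$ by the rational $\frac{x}{y}$ with $\begin{pmatrix}x\\ y\end{pmatrix}=\mathbf{D}\begin{pmatrix}1\\ 1\end{pmatrix}$. The Eisenstein-Stern tree (also known as the Calkin-Wilf tree) is obtained by replacing each node $\mathbf{D}$ by the rational $\frac{y}{x}$ with $(x\ \ y)=(1\ \ 1)\,\mathbf{D}$. *)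

(* Defs.v *)
From HB Require Import structures.
From mathcomp Require Import all_boot all_order all_algebra.

Set Implicit Arguments.
Unset Strict Implicit.
Unset Printing Implicit Defensive.

Import Order.TTheory GRing.Theory Num.Theory.
Local Open Scope ring_scope.

Definition mx2 (a b c d : int) : 'M[int]_2 :=
  \matrix_(i < 2, j < 2) (nth [::] [:: [:: a; b]; [:: c; d]] i)`_j.

Definition Lmx : 'M[int]_2 := mx2 1 0
                                  1 1.
Definition Rmx : 'M[int]_2 := mx2 1 1
                                  0 1.

(* The letter L is encoded by [false] and R by [true], so that the library
   order [false < true] on [bool] is L < R. *)
Definition mu (s : seq bool) : 'M[int]_2 :=
  \prod_(c <- s) (if c then Rmx else Lmx).

(* [seqlexi bool] is [seq bool] equipped with the lexicographic order. *)
Definition level_lt (s t : seq bool) : bool :=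
  (size s < size t)%N ||
  ((size s == size t) && ((s : seqlexi bool) < (t : seqlexi bool))%O).

(* [s 0, s 1, ...] is the list of all strings in level order; these conditions
   determine [s] uniquely. *)
Definition level_order_list (s : nat -> seq bool) : Prop :=
  bijective s /\ (forall i j : nat, (i < j)%N -> level_lt (s i) (s j)).

(* A tree is represented by the function sending the string of left/right
   branches from the root to the node it reaches; the tree of products is [mu]
   itself. *)
Definition stern_brocot (s : seq bool) : rat :=
  let v := mu s *m (const_mx 1 : 'cV[int]_2) in
  (v 0 0)%:Q / (v 1 0)%:Q.

Definition eisenstein_stern (s : seq bool) : rat :=
  let v := (const_mx 1 : 'rV[int]_2) *m mu s in
  (v 0 1)%:Q / (v 0 0)%:Q.

Definition colsum (D : 'M[int]_2) (j : 'I_2) : int := D 0 j + D 1 j.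

(* Division in [rat] is total ([x / 0 = 0]), so this is the intended step only
   when [colsum D 0 != 0]. *)
Definition Dstep (D : 'M[int]_2) : 'M[int]_2 :=
  if colsum D 0 == 1 then mx2 1            0
                              (colsum D 1) 1
  else
    let j := Num.floor ((colsum D 1 - 1)%:Q / (colsum D 0)%:Q) in
    D *m mx2 (2 * j + 1) 1
             (- 1)       0.

Definition Dseq (i : nat) : 'M[int]_2 := iter i Dstep 1%:M.

Definition p_ (i : nat) : int := (Dseq i *m (const_mx 1 : 'cV[int]_2)) 0 0.
Definition q_ (i : nat) : int := (Dseq i *m (const_mx 1 : 'cV[int]_2)) 1 0.
Definition m_ (i : nat) : int := ((const_mx 1 : 'rV[int]_2) *m Dseq i) 0 0.
Definition n_ (i : nat) : int := ((const_mx 1 : 'rV[int]_2) *m Dseq i) 0 1.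

Definition lowest_form (x y : int) : bool :=
  [&& 0 < x, 0 < y & coprimez x y].

(* The fractions [x i / y i] are positive, in lowest form, and every positive
   rational occurs among them exactly once. *)
Definition enumerates_posrat (x y : nat -> int) : Prop :=
  (forall i : nat, lowest_form (x i) (y i)) /\
  (forall r : rat, 0 < r -> exists! i : nat, (x i)%:Q / (y i)%:Q = r).

(* Main.v *)
Require Import Defs.
From HB Require Import structures.
From mathcomp Require Import all_boot all_order all_algebra.
From mathcomp Require Import zify ring.

Set Implicit Arguments.
Unset Strict Implicit.
Unset Printing Implicit Defensive.

Import Order.TTheory GRing.Theory Num.Theory.
Local Open Scope ring_scope.

(** In level order a string [A L R^j] is followed by [A R L^j], and [R^k] by
    [L^(k+1)]; read backwards this is the increment of bijective binary
    numeration, so iterating it from the empty string visits every string once.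
    On matrices, [(1 1) mu(A) = (a b)] with [a, b > 0] gives
    [(1 1) mu(A L R^j) = (a+b  j(a+b)+b)], so the floor recovers [j], and
    [L R^j] times the step matrix is [R L^j].  Finally
    the fraction attached to a string is computed by the moves
    [(x, y) -> (x, x+y)] and [(x, y) -> (x+y, y)], and undoing them is the
    subtractive Euclidean algorithm; the two trees differ only by reading the
    string forwards or backwards. *)

(** * Level order as bijective binary numeration *)

(* Strings are read backwards here: the head is the last letter. *)
Fixpoint incr (u : seq bool) : seq bool :=
  match u with
  | [::] => [:: false]
  | false :: t => true :: t
  | true :: t => false :: incr t
  end.

(** The letters [false] and [true] are the digits 1 and 2, least significant first. *)
Fixpoint bij_val (u : seq bool) : nat :=
  if u is b :: t then (b + (bij_val t).*2).+1 else 0.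

Lemma bij_val_incr u : bij_val (incr u) = (bij_val u).+1.
Proof. by elim: u => [|[] t IHt] //=; rewrite IHt /=; lia. Qed.

(** Two increments of a nonempty string restore its head and carry once into its tail. *)
Lemma iter_incr_double n b t :
  iter n.*2 incr (b :: t) = b :: iter n incr t.
Proof. by elim: n => [|n IHn] //=; rewrite IHn; case: b {IHn}. Qed.

Lemma iter_bij_val u : iter (bij_val u) incr [::] = u.
Proof.
elim: u => [|b t IHt] //=.
(* The first increment creates the head [false], the doubled part builds [t] behind it, and the last
   [b] increments correct the head. *)
by rewrite -iterS -addnS iterD iterSr /= iter_incr_double IHt; case: b.
Qed.

Lemma bij_val_iter n : bij_val (iter n incr [::]) = n.
Proof. by elim: n => [|n IHn] //=; rewrite bij_val_incr IHn. Qed.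

Lemma incr_cat_nseq k t : incr (nseq k true ++ t) = nseq k false ++ incr t.
Proof. by elim: k => [|k IHk] //=; rewrite IHk. Qed.

Lemma incr_nseq k : incr (nseq k true) = nseq k.+1 false.
Proof. by elim: k => [|k IHk] //=; rewrite IHk. Qed.

Definition level_succ (w : seq bool) : seq bool := rev (incr (rev w)).

Definition level_string (i : nat) : seq bool := rev (iter i incr [::]).

Lemma level_stringS i : level_string i.+1 = level_succ (level_string i).
Proof. by rewrite /level_succ revK. Qed.

Lemma level_string_bij : bijective level_string.
Proof.
exists (bij_val \o rev) => [i|w] /=; rewrite /level_string.
  by rewrite revK bij_val_iter.
by rewrite iter_bij_val revK.
Qed.

(** Either the string ends its level, or its last L has only R's after it. *)
Variant level_succ_spec : seq bool -> seq bool -> Prop :=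
  | LevelSuccFull k : level_succ_spec (nseq k true) (nseq k.+1 false)
  | LevelSuccCarry k A :
      level_succ_spec (A ++ false :: nseq k true) (A ++ true :: nseq k false).

Lemma level_succP w : level_succ_spec w (level_succ w).
Proof.
have [k [def_w|[t def_w]]] : exists k, rev w = nseq k true \/
    exists t, rev w = nseq k true ++ false :: t.
- elim: (rev w) => [|[] u [k IHu]].
  + by exists 0; left.
  + exists k.+1; case: IHu => [->|[t ->]]; first by left.
    by right; exists t.
  + by exists 0; right; exists u.
- rewrite /level_succ -{1}[w]revK def_w incr_nseq !rev_nseq.
  exact: LevelSuccFull.
- rewrite /level_succ -{1}[w]revK def_w incr_cat_nseq !rev_cat !rev_nseq.
  rewrite !rev_cons !cat_rcons; exact: LevelSuccCarry.
Qed.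

Lemma ltxi_cat2l (s t u : seqlexi bool) :
  ((s ++ t : seqlexi bool) < (s ++ u : seqlexi bool))%O = (t < u)%O.
Proof. by elim: s => [|b s IHs] //=; rewrite ltxi_cons lexx /= IHs. Qed.

Lemma level_lt_trans : transitive level_lt.
Proof.
move=> t s u; rewrite /level_lt.
case/orP=> [lt_st|/andP[/eqP-> lt_st]]; last first.
  case/orP=> [->//|/andP[-> lt_tu]].
  by rewrite (lt_trans lt_st lt_tu) orbT.
by case/orP=> [lt_tu|/andP[/eqP<- _]]; rewrite ?lt_st // (ltn_trans lt_st).
Qed.

Lemma level_lt_succ w : level_lt w (level_succ w).
Proof.
rewrite /level_lt; case: level_succP => [k|k A].
  by rewrite !size_nseq ltnSn.
by rewrite ltxi_cat2l ltxi_cons !size_cat /= !size_nseq eqxx orbT.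
Qed.

Lemma level_string_level_order : level_order_list level_string.
Proof.
split; first exact: level_string_bij.
move=> i j; apply: (homo_ltn level_lt_trans) => n.
by rewrite level_stringS level_lt_succ.
Qed.

(** * Two-by-two matrices and column sums *)

Lemma mul_mx2E m (A : 'M[int]_(m, 2)) a b c d i :
  ((A *m mx2 a b c d) i 0 = A i 0 * a + A i 1 * c) *
  ((A *m mx2 a b c d) i 1 = A i 0 * b + A i 1 * d).
Proof.
split; rewrite mxE !big_ord_recl big_ord0 addr0 !mxE /=;
  by congr (_ * _ + A i _ * _); apply: val_inj.
Qed.

Lemma mx2_mulE n (A : 'M[int]_(2, n)) a b c d j :
  ((mx2 a b c d *m A) 0 j = a * A 0 j + b * A 1 j) *
  ((mx2 a b c d *m A) 1 j = c * A 0 j + d * A 1 j).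
Proof.
split; rewrite mxE !big_ord_recl big_ord0 addr0 !mxE /=;
  by congr (_ * _ + _ * A _ j); apply: val_inj.
Qed.

Lemma eq_mx2 (A : 'M[int]_2) a b c d :
  A 0 0 = a -> A 0 1 = b -> A 1 0 = c -> A 1 1 = d -> A = mx2 a b c d.
Proof.
move=> <- <- <- <-; apply/matrixP => i j; rewrite mxE.
by case: i => [[|[|//]] ?]; case: j => [[|[|//]] ?] /=; congr (A _ _);
  apply: val_inj.
Qed.

Lemma mx2_mul a b c d a' b' c' d' :
  mx2 a b c d *m mx2 a' b' c' d' =
  mx2 (a * a' + b * c') (a * b' + b * d') (c * a' + d * c') (c * b' + d * d').
Proof. by apply: eq_mx2; rewrite mul_mx2E !mxE. Qed.

Lemma mx2_1 : mx2 1 0 0 1 = 1%:M.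
Proof. by apply/esym/eq_mx2; rewrite mxE. Qed.

Lemma mu_cons c w : mu (c :: w) = (if c then Rmx else Lmx) *m mu w.
Proof. by rewrite /mu big_cons mulmxE. Qed.

Lemma mu_cat w w' : mu (w ++ w') = mu w *m mu w'.
Proof. by rewrite /mu big_cat mulmxE. Qed.

Lemma mu_nil : mu [::] = 1%:M.
Proof. by rewrite /mu big_nil. Qed.

Lemma mu_rcons w c : mu (rcons w c) = mu w *m (if c then Rmx else Lmx).
Proof. by rewrite -cats1 mu_cat mu_cons mu_nil mulmx1. Qed.

Lemma mu_nseqR k : mu (nseq k true) = mx2 1 k%:Z 0 1.
Proof.
elim: k => [|k IHk]; first by rewrite mu_nil mx2_1.
by rewrite mu_cons IHk mx2_mul; congr mx2; lia.
Qed.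

Lemma mu_nseqL k : mu (nseq k false) = mx2 1 0 k%:Z 1.
Proof.
elim: k => [|k IHk]; first by rewrite mu_nil mx2_1.
by rewrite mu_cons IHk mx2_mul; congr mx2; lia.
Qed.

Lemma colsum_mul_mx2 (A : 'M[int]_2) a b c d :
  (colsum (A *m mx2 a b c d) 0 = colsum A 0 * a + colsum A 1 * c) *
  (colsum (A *m mx2 a b c d) 1 = colsum A 0 * b + colsum A 1 * d).
Proof. by split; rewrite /colsum !mul_mx2E; ring. Qed.

Lemma colsum_mx2 a b c d :
  (colsum (mx2 a b c d) 0 = a + c) * (colsum (mx2 a b c d) 1 = b + d).
Proof. by split; rewrite /colsum !mxE. Qed.

Lemma row1_mul (A : 'M[int]_2) j :
  ((const_mx 1 : 'rV[int]_2) *m A) 0 j = colsum A j.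
Proof.
rewrite mxE !big_ord_recl big_ord0 addr0 !mxE !mul1r /colsum.
by congr (A _ _ + A _ _); apply: val_inj.
Qed.

(** * Euclidean pairs and positive rationals *)

Fixpoint euclid_pair (w : seq bool) : nat * nat :=
  if w is c :: w' then
    let: (x, y) := euclid_pair w' in
    (if c then (x + y, y) else (x, x + y))%N
  else (1, 1)%N.

Lemma mu_mul_col1 w :
  ((mu w *m (const_mx 1 : 'cV[int]_2)) 0 0 = (euclid_pair w).1%:Z) *
  ((mu w *m (const_mx 1 : 'cV[int]_2)) 1 0 = (euclid_pair w).2%:Z).
Proof.
elim: w => [|c w [IH0 IH1]]; first by rewrite mu_nil mul1mx !mxE.
rewrite mu_cons -mulmxA /=; case: (euclid_pair w) IH0 IH1 => x y /= IH0 IH1.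
by case: c; rewrite !mx2_mulE IH0 IH1 /=; split; lia.
Qed.

(** Appending a letter on the right adds one column sum to the other, the move that [euclid_pair]
    makes for a head letter; hence the reversal. *)
Lemma colsum_mu w :
  (colsum (mu w) 1 = (euclid_pair (rev w)).1%:Z) *
  (colsum (mu w) 0 = (euclid_pair (rev w)).2%:Z).
Proof.
elim/last_ind: w => [|w c [IH1 IH0]]; first by rewrite mu_nil /colsum !mxE.
rewrite mu_rcons rev_rcons /=.
case: (euclid_pair (rev w)) IH0 IH1 => x y /= IH0 IH1.
by case: c; rewrite !colsum_mul_mx2 IH0 IH1 /=; split; lia.
Qed.

Lemma euclid_pair_gt0 w :
  (0 < (euclid_pair w).1)%N && (0 < (euclid_pair w).2)%N.
Proof. by elim: w => [|[] w] //=; case: (euclid_pair w) => x y /=; lia. Qed.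

Lemma coprime_euclid_pair w : coprime (euclid_pair w).1 (euclid_pair w).2.
Proof.
rewrite /coprime; elim: w => [|[] w] //=; case: (euclid_pair w) => x y /= co_xy.
  by rewrite gcdnC gcdnDr gcdnC.
by rewrite gcdnDl.
Qed.

(** By positivity, comparing the two entries reveals the head: the first is larger for R, the second
    for L, and they agree only for the empty string. *)
Lemma euclid_pair_inj : injective euclid_pair.
Proof.
elim=> [|c w IHw] [|c' w'] //=.
- have := euclid_pair_gt0 w'; case: (euclid_pair w') => x y /= xy_gt0.
  by case: c' => - [] *; exfalso; lia.
- have := euclid_pair_gt0 w; case: (euclid_pair w) => x y /= xy_gt0.
  by case: c => - [] *; exfalso; lia.
have := euclid_pair_gt0 w; have := euclid_pair_gt0 w'; move: (IHw w').
case: (euclid_pair w) => x y; case: (euclid_pair w') => x' y' /= IH gt0 gt0'.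
case: c; case: c' => -[eq1 eq2]; try (exfalso; lia);
  by rewrite IH //; congr (_, _); lia.
Qed.

Lemma euclid_pair_surj x y :
  (0 < x)%N -> (0 < y)%N -> coprime x y -> exists w, euclid_pair w = (x, y).
Proof.
have [n] := ubnP (x + y); elim: n x y => // n IHn x y lt_xy_n x_gt0 y_gt0 co_xy.
have [lt_xy|lt_yx|eq_xy] := ltngtP x y.
- have [||||w def_w] := IHn x (y - x)%N; rewrite ?subn_gt0 //; first by lia.
    by rewrite /coprime -(gcdnDr x) subnK // ltnW.
  by exists (false :: w); rewrite /= def_w subnKC // ltnW.
- have [||||w def_w] := IHn (x - y)%N y; rewrite ?subn_gt0 //; first by lia.
    by rewrite /coprime gcdnC -(gcdnDr y) subnK 1?gcdnC // ltnW.
  by exists (true :: w); rewrite /= def_w subnK // ltnW.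
(* Equal coprime entries are both 1, the root of the tree. *)
- by exists [::]; move: co_xy; rewrite eq_xy /coprime gcdnn => /eqP->.
Qed.

(** The bijection [f] is arbitrary so that both trees are covered, one of them through reversed
    strings. *)
Lemma enumerates_posrat_euclid (f : nat -> seq bool) (x y : nat -> int) :
  bijective f ->
  (forall i, x i = (euclid_pair (f i)).1%:Z) ->
  (forall i, y i = (euclid_pair (f i)).2%:Z) ->
  enumerates_posrat x y.
Proof.
move=> [g fK gK] def_x def_y; split=> [i|r r_gt0].
  rewrite /lowest_form def_x def_y !ltz_nat /coprimez /gcdz !absz_nat.
  have /andP[-> ->] := euclid_pair_gt0 (f i).
  by have /eqP -> := coprime_euclid_pair (f i).
have num_gt0 : 0 < numq r by rewrite numq_gt0.
have [|||w def_w] := @euclid_pair_surj `|numq r| `|denq r|;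
  rewrite ?coprime_num_den ?absz_gt0 ?gt_eqF ?denq_gt0 //.
exists (g w); split=> [|j def_r].
  by rewrite def_x def_y gK def_w /= !gtz0_abs ?denq_gt0 ?divq_num_den.
rewrite -[j]fK; congr g; apply: euclid_pair_inj; rewrite def_w -def_r.
have /andP[x_gt0 y_gt0] := euclid_pair_gt0 (f j).
have co_xy := coprime_euclid_pair (f j).
(* Coprimality makes the numerator and denominator of the quotient the pair itself. *)
rewrite def_x def_y coprimeq_num ?coprimeq_den //.
rewrite gtr0_sg ?ltz_nat // mul1r gt_eqF ?ltz_nat //.
by case: euclid_pair.
Qed.

(** * The matrix step realises the successor in level order *)

Lemma Dstep_mu w : Dstep (mu w) = mu (level_succ w).
Proof.
case: level_succP => [k|k A]; rewrite /Dstep.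
  rewrite mu_nseqR mu_nseqL !colsum_mx2 addr0 eqxx.
  by congr mx2; lia.
rewrite !mu_cat !mu_cons mu_nseqR mu_nseqL !mx2_mul !colsum_mul_mx2.
have /andP[] := euclid_pair_gt0 (rev A); rewrite !colsum_mu.
case: (euclid_pair (rev A)) => b a /= b_gt0 a_gt0.
(* The first column sum is [a + b], at least 2. *)
rewrite ifF; last by apply/eqP; lia.
(* The numerator is [k * (a + b) + (b - 1)], where [0 <= b - 1 < a + b]. *)
rewrite (@floor_def _ _ k%:Z); last first.
  rewrite ler_pdivlMr ?ltr_pdivrMr ?ltr0z; try lia.
  by rewrite -!intrM ler_int ltr_int; lia.
by rewrite -mulmxA mx2_mul; congr (_ *m mx2 _ _ _ _); lia.
Qed.

Lemma Dseq_mu i : Dseq i = mu (level_string i).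
Proof.
elim: i => [|i IHi]; first by rewrite mu_nil.
by rewrite level_stringS -Dstep_mu -IHi.
Qed.

Theorem mainTheorem4 :
  (* the sequence is well defined: no division by zero occurs *)
  (forall i : nat, colsum (Dseq i) 0 != 1 -> colsum (Dseq i) 0 != 0) /\
  exists s : nat -> seq bool,
    [/\ level_order_list s,
        forall i : nat, Dseq i = mu (s i),
        (* (a) *)
        enumerates_posrat p_ q_ /\
        (forall i : nat, (p_ i)%:Q / (q_ i)%:Q = stern_brocot (s i))
      & (* (b) *)
        enumerates_posrat n_ m_ /\
        (forall i : nat, (n_ i)%:Q / (m_ i)%:Q = eisenstein_stern (s i))].
Proof.
split=> [i _|].
  rewrite Dseq_mu colsum_mu eqz_nat -lt0n.
  by case/andP: (euclid_pair_gt0 (rev (level_string i))).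
exists level_string; split; first exact: level_string_level_order.
- exact: Dseq_mu.
- split=> [|i]; last by rewrite /p_ /q_ Dseq_mu.
  apply: (enumerates_posrat_euclid level_string_bij) => i;
    by rewrite /p_ /q_ Dseq_mu mu_mul_col1.
- split=> [|i]; last by rewrite /n_ /m_ Dseq_mu.
  (* Column sums read the string reversed, so the enumerating bijection is [rev] after
     [level_string]. *)
  have rev_bij : bijective (@rev bool) by exists rev; exact: revK.
  apply: (enumerates_posrat_euclid (bij_comp rev_bij level_string_bij)) => i;
    by rewrite /n_ /m_ Dseq_mu row1_mul colsum_mu.
Qed.
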